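(* Let $n\geq 1$ and $c_{-j}=c_j\in\mathbb R$ for $0\leq j\leq n$, and suppose that $C_{n+1}=(c_{r-s})_{r,s=0}^n$ is positive definite. Let $Q_n$ be its monic orthogonal polynomial (defined in the context), and put $$P(z)=zQ_n(z)-(-1)^nQ_n^*(z).$$ If every zero of $P$ belongs to $\{z\in\mathbb C: |z|=1,\ \Re z>0\}$, or equivalently $P(-z)$ is Hurwitz, then $$\det C_{n+1}^{(r,s)}>0,\quad 0\leq r,s\leq n.$$ Thus $C_{n+1}$ may play the role of $B$ in the following determinant comparison: for every real symmetric positive-definite Toeplitz matrix $A=(a_{r-s})_{r,s=0}^n$ with $a_{-j}=a_j$ and $(-1)^j(c_j-a_j)\geq 0$ for $0\leq j\leq n$, one has $\det A\leq\det C_{n+1}$, with equality if and only if $A=C_{n+1}$.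
   Context: Row and column indices of matrices start at $0$; $M^{(r,s)}$ denotes the submatrix of $M$ obtained by deleting row $r$ and column $s$. A polynomial is called Hurwitz if all its zeros lie in the open left half-plane. Given the positive-definite matrix $C_{n+1}=(c_{r-s})_{r,s=0}^n$, let $C_m=(c_{r-s})_{r,s=0}^{m-1}$ and let $\mathcal L$ be the linear functional on $\operatorname{span}\{z^j:-n\leq j\leq n\}$ with $\mathcal L[z^j]=c_{-j}$; for polynomials $f,g$ of degree at most $n$ put $\langle f,g\rangle=\mathcal L[\overline f g]$, where conjugation is taken on the unit circle (so $\overline{z}=z^{-1}$). $Q_n$ is the monic polynomial of degree $n$ orthogonal to $1,z,\ldots,z^{n-1}$; explicitly $$Q_n(z)=\frac{1}{\det C_n}\det\begin{pmatrix} c_0&c_{-1}&\cdots&c_{-n}\\ c_1&c_0&\cdots&c_{1-n}\\ \vdots&\vdots&&\vdots\\ c_{n-1}&c_{n-2}&\cdots&c_{-1}\\ 1&z&\cdots&z^n\end{pmatrix}.$$ The reversed polynomial is $Q_n^*(z)=z^n\overline{Q_n(1/\overline z)}$, with its value at $z=0$ defined by polynomial continuation. The polynomial $P$ has $n+1$ simple zeros, all on the unit circle. *)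

(* Defs.v *)
From HB Require Import structures.
From mathcomp Require Import all_boot all_order all_algebra.
From mathcomp Require Import reals complex.

Set Implicit Arguments.
Unset Strict Implicit.
Unset Printing Implicit Defensive.

Import Order.TTheory GRing.Theory Num.Theory.

Local Open Scope complex_scope.
Local Open Scope ring_scope.

(* C_m = (c_{r-s})_{0 <= r, s < m} *)
Definition toeplitz (R : realType) (c : int -> R) (m : nat) : 'M[R]_m :=
  \matrix_(r, s) c (r%:Z - s%:Z).

Definition posdef (R : realType) (m : nat) (M : 'M[R]_m) : Prop :=
  M^T = M /\ forall x : 'rV[R]_m, x != 0 -> 0 < (x *m M *m x^T) 0 0.

(* M^{(r,s)} *)
Definition delete_row_col (R : realType) (n : nat) (r s : 'I_n.+1)
    (M : 'M[R]_n.+1) : 'M[R]_n :=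
  row' r (col' s M).

(* f^*(z) = z^n conj(f(1 / conj z)), as a polynomial, for deg f <= n *)
Definition revpoly (R : realType) (n : nat) (f : {poly R[i]}) : {poly R[i]} :=
  \poly_(k < n.+1) (f`_(n - k))^*.

(* A Laurent polynomial in span {z^j : -n <= j <= n} is written z^-n h(z) with
   deg h <= 2n; [moment c n h] is the value L[z^-n h], where L[z^j] = c_{-j}. *)
Definition moment (R : realType) (c : int -> R) (n : nat) (h : {poly R[i]}) :
    R[i] :=
  \sum_(k < n.*2.+1) h`_k * (c (n%:Z - k%:Z))%:C.

(* <f, g> = L[conj f g] for deg f, deg g <= n; on the unit circle
   conj f = z^-n f^*. *)
Definition opuc_dot (R : realType) (c : int -> R) (n : nat)
    (f g : {poly R[i]}) : R[i] :=
  moment c n (revpoly n f * g).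

Definition monic_orthogonal (R : realType) (c : int -> R) (n : nat)
    (Q : {poly R[i]}) : Prop :=
  [/\ size Q = n.+1, Q \is monic
    & forall k : nat, (k < n)%N -> opuc_dot c n 'X^k Q = 0].

(* P(z) = z Q(z) - (-1)^n Q^*(z) *)
Definition paraorth (R : realType) (n : nat) (Q : {poly R[i]}) :
    {poly R[i]} :=
  'X * Q - (-1) ^+ n *: revpoly n Q.

Definition hurwitz (R : realType) (p : {poly R[i]}) : Prop :=
  forall z : R[i], root p z -> complex.Re z < 0.

Definition zeros_on_right_semicircle (R : realType) (p : {poly R[i]}) : Prop :=
  forall z : R[i], root p z -> `|z| = 1 /\ 0 < complex.Re z.

Lemma horner_revpoly (R : realType) (n : nat) (f : {poly R[i]}) (z : R[i]) :
  (size f <= n.+1)%N -> z != 0 ->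
  (revpoly n f).[z] = z ^+ n * (f.[(z^*)^-1])^*.
Proof.
move=> sf z0; rewrite horner_poly (horner_coef_wide _ sf) rmorph_sum mulr_sumr.
rewrite (reindex_inj rev_ord_inj); apply: eq_bigr => k _ /=.
have kn : (k <= n)%N by rewrite -ltnS.
rewrite subSS subKn // rmorphM rmorphXn /= fmorphV /= conjCK mulrCA.
by rewrite exprB ?unitfE // exprVn.
Qed.

Lemma opuc_dotE (R : realType) (c : int -> R) (n : nat) (f g : {poly R[i]}) :
  (size f <= n.+1)%N -> (size g <= n.+1)%N ->
  opuc_dot c n f g =
    \sum_(r < n.+1) \sum_(s < n.+1) (f`_r)^* * g`_s * (c (r%:Z - s%:Z))%:C.
Proof.
move=> sf sg; rewrite /opuc_dot.
have momentZD a p q : moment c n (a *: p + q) = a * moment c n p + moment c n q.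
  rewrite /moment mulr_sumr -big_split; apply: eq_bigr => k _ /=.
  by rewrite coefD coefZ mulrDl mulrA.
have moment0 : moment c n 0 = 0.
  by rewrite /moment big1 // => k _; rewrite coef0 mul0r.
have moment_sum (I : finType) (a : I -> R[i]) (F : I -> {poly R[i]}) :
    moment c n (\sum_i a i *: F i) = \sum_i a i * moment c n (F i).
  apply: (big_ind2 (fun p x => moment c n p = x)) => // [p x q y <- <-|i _].
    by rewrite -[p]scale1r momentZD mul1r scale1r.
  by rewrite -[X in moment _ _ X]addr0 momentZD moment0 addr0.
have momentX r s : (r <= n)%N -> (s <= n)%N ->
    moment c n 'X^(n - r + s) = (c (r%:Z - s%:Z))%:C.
  move=> rn sn; have lt : (n - r + s < n.*2.+1)%N.
    by rewrite ltnS -addnn leq_add ?leq_subr.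
  rewrite /moment (bigD1 (Ordinal lt)) //= coefXn eqxx mul1r big1 ?addr0.
    by congr (c _)%:C; rewrite PoszD -subzn // opprD opprB addrA addrCA subrr addr0.
  by move=> k; rewrite coefXn -val_eqE /= => /negPf ->; rewrite mul0r.
have Ef : revpoly n f = \sum_(r < n.+1) (f`_r)^* *: 'X^(n - r).
  rewrite /revpoly poly_def (reindex_inj rev_ord_inj); apply: eq_bigr => k _ /=.
  by rewrite subSS subKn // -ltnS.
have Eg : g = \sum_(s < n.+1) g`_s *: 'X^s.
  rewrite -poly_def; apply/polyP => k; rewrite coef_poly.
  by case: ltnP => // nk; rewrite nth_default // (leq_trans sg).
have -> : revpoly n f * g =
    \sum_(r < n.+1) (f`_r)^* *: \sum_(s < n.+1) g`_s *: 'X^(n - r + s).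
  rewrite Ef {1}Eg mulr_suml; apply: eq_bigr => r _.
  rewrite -scalerAl mulr_sumr; congr (_ *: _); apply: eq_bigr => s _.
  by rewrite -scalerAr -exprD.
rewrite moment_sum; apply: eq_bigr => r _.
rewrite moment_sum mulr_sumr; apply: eq_bigr => s _.
by rewrite momentX -1?ltnS ?mulrA.
Qed.

Lemma opuc_dotXE (R : realType) (c : int -> R) (n k : nat) (g : {poly R[i]}) :
  (k <= n)%N -> (size g <= n.+1)%N ->
  opuc_dot c n 'X^k g = \sum_(s < n.+1) g`_s * (c (k%:Z - s%:Z))%:C.
Proof.
move=> kn sg; have kn1 : (k < n.+1)%N by [].
rewrite opuc_dotE ?size_polyXn // (bigD1 (Ordinal kn1)) //=.
rewrite [X in _ + X]big1 ?addr0.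
  by apply: eq_bigr => s _; rewrite coefXn eqxx rmorph1 mul1r.
move=> r; rewrite -val_eqE /= => /negPf rk; apply: big1 => s _.
by rewrite coefXn rk rmorph0 !mul0r.
Qed.

(* Rows 0..n-1 hold the constants c_{r-s}, row n holds 1, z, ..., z^n. *)
Definition opuc_det (R : realType) (c : int -> R) (n : nat) : {poly R[i]} :=
  ((\det (toeplitz c n))^-1)%:C *:
    \det (\matrix_(r < n.+1, s < n.+1)
            (if (r < n)%N then ((c (r%:Z - s%:Z))%:C)%:P else 'X^s)).

Lemma det_toeplitz_neq0 (R : realType) (c : int -> R) (n : nat) :
  posdef (toeplitz c n.+1) -> \det (toeplitz c n) != 0.
Proof.
move=> [_ pos]; apply/negP => /det0P[v v0 vC].
pose x : 'rV[R]_n.+1 := \row_j oapp (v 0) 0 (insub (val j)).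
have xw (j : 'I_n) : x 0 (widen_ord (leqnSn n) j) = v 0 j.
  by rewrite mxE /= insubT //= => lt; congr (v 0 _); apply: val_inj.
have xm : x 0 ord_max = 0 by rewrite mxE /= insubF ?ltnn.
have x0 : x != 0.
  apply: contraNneq v0 => x0; apply/eqP/rowP => j.
  by rewrite -xw x0 !mxE.
have := pos x x0; suff -> : (x *m toeplitz c n.+1 *m x^T) 0 0 = 0.
  by rewrite ltxx.
rewrite mxE big_ord_recr /= [x^T _ _]mxE xm mulr0 addr0 big1 // => j _.
rewrite mxE big_ord_recr /= xm mul0r addr0.
suff -> : \sum_(i < n) x 0 (widen_ord (leqnSn n) i) *
    toeplitz c n.+1 (widen_ord (leqnSn n) i) (widen_ord (leqnSn n) j) = 0.
  by rewrite mul0r.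
transitivity ((v *m toeplitz c n) 0 j); last by rewrite vC mxE.
by rewrite [RHS]mxE; apply: eq_bigr => i _; rewrite xw [in LHS]mxE [in RHS]mxE.
Qed.

Lemma monic_orthogonal_uniq (R : realType) (c : int -> R) (n : nat)
    (P Q : {poly R[i]}) :
  posdef (toeplitz c n.+1) ->
  monic_orthogonal c n P -> monic_orthogonal c n Q -> P = Q.
Proof.
move=> /det_toeplitz_neq0 dC [sP mP oP] [sQ mQ oQ].
pose T : 'M[R[i]]_n := (map_mx (real_complex R) (toeplitz c n))^T.
have Tu : T \in unitmx.
  by rewrite unitmx_tr unitmxE det_map_mx unitfE fmorph_eq0.
have PQn : P`_n = Q`_n.
  by move: mP mQ; rewrite !monicE /lead_coef sP sQ => /eqP -> /eqP ->.
pose v : 'rV[R[i]]_n := \row_j (P`_j - Q`_j).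
have vT : v *m T = 0.
  apply/rowP => k; rewrite !mxE.
  have := oP k (ltn_ord k); have := oQ k (ltn_ord k).
  rewrite !opuc_dotXE ?sP ?sQ ?(ltnW (ltn_ord k)) // !big_ord_recr /= PQn.
  move=> Q0 P0; have /eqP := etrans P0 (esym Q0).
  rewrite (inj_eq (addIr _)) -subr_eq0 -sumrB => /eqP E; rewrite -[RHS]E.
  by apply: eq_bigr => s _; rewrite !mxE mulrBl.
have v0 : v = 0 by rewrite -[v](mulmxK Tu) vT mul0mx.
apply/polyP => j; case: (ltngtP j n) => [jn|nj|->//].
  by have /rowP/(_ (Ordinal jn)) := v0; rewrite !mxE => /eqP; rewrite subr_eq0 => /eqP.
by rewrite !nth_default ?sP ?sQ.
Qed.

Lemma monic_orthogonal_det (R : realType) (c : int -> R) (n : nat) :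
  posdef (toeplitz c n.+1) -> monic_orthogonal c n (opuc_det c n).
Proof.
move=> /det_toeplitz_neq0 dC.
pose B := \matrix_(r < n, s < n.+1) (c (r%:Z - s%:Z))%:C.
pose k (s : 'I_n.+1) := (-1) ^+ (n + s) * \det (col' s B).
have bumpn (i : 'I_n) : bump n i = i by rewrite /bump leqNgt ltn_ord.
have det_last (v : 'I_n.+1 -> R[i]) :
    \det (\matrix_(r < n.+1, s < n.+1)
       (if (r < n)%N then (c (r%:Z - s%:Z))%:C else v s)) = \sum_s v s * k s.
  rewrite (expand_det_row _ ord_max); apply: eq_bigr => s _.
  rewrite mxE /= ltnn; congr (_ * (_ * \det _)).
  by apply/matrixP => i j; rewrite !mxE /= bumpn ltn_ord.
have detM : opuc_det c n =
    \poly_(s < n.+1) (((\det (toeplitz c n))^-1)%:C * k (inord s)).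
  rewrite poly_def /opuc_det (expand_det_row _ ord_max) scaler_sumr.
  apply: eq_bigr => s _; rewrite mxE /= ltnn inord_val -scalerA; congr (_ *: _).
  rewrite -mul_polyC mulrC; congr (_ * _).
  rewrite /cofactor /k rmorphM rmorphXn rmorphN1 /= -det_map_mx.
  congr (_ * \det _); apply/matrixP => i j.
  by rewrite !mxE /= bumpn ltn_ord.
have kn : k ord_max = (\det (toeplitz c n))%:C.
  rewrite /k /= addnn -signr_odd odd_double mul1r -det_map_mx.
  congr (\det _); apply/matrixP => i j.
  by rewrite !mxE /= bumpn.
have cn : (opuc_det c n)`_n = 1.
  rewrite detM coef_poly ltnSn (_ : inord n = ord_max).
    by rewrite kn -rmorphM mulVf.
  by apply: val_inj; rewrite /= inordK.
have sz : size (opuc_det c n) = n.+1.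
  apply/anti_leq; rewrite {1}detM size_poly ltnNge; apply/negP => le.
  by move: cn; rewrite nth_default // => /eqP; rewrite eq_sym oner_eq0.
split=> //; first by rewrite monicE /lead_coef sz cn.
move=> j jn; rewrite opuc_dotXE ?sz ?(ltnW jn) // detM.
have jn1 : (j < n.+1)%N by rewrite ltnW.
have alt : \sum_s (c (j%:Z - (nat_of_ord s)%:Z))%:C * k s = 0.
  rewrite -det_last.
  apply: (@determinant_alternate _ _ _ (Ordinal jn1) ord_max).
    by rewrite -val_eqE /= neq_ltn jn.
  by move=> s; rewrite !mxE /= jn ltnn.
transitivity (((\det (toeplitz c n))^-1)%:C *
    \sum_s (c (j%:Z - (nat_of_ord s)%:Z))%:C * k s); last by rewrite alt mulr0.
rewrite mulr_sumr; apply: eq_bigr => s _.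
by rewrite coef_poly ltn_ord inord_val mulrAC mulrA.
Qed.

(* Main.v *)
Require Import Defs.
From HB Require Import structures.
From mathcomp Require Import all_boot all_order all_algebra.
From mathcomp Require Import reals complex.
From mathcomp Require Import ring lra zify.

Import Order.TTheory GRing.Theory Num.Theory.

Local Open Scope complex_scope.
Local Open Scope ring_scope.

(** The form <f, g> is defined on polynomials of degree at most n. One further
    moment c_{n+1} can be chosen so that, for the enlarged form on degree at
    most n+1, the polynomial P is orthogonal to everything: it is already
    orthogonal to z, ..., z^n because Q and its reversal are, c_{n+1} is chosen
    to make it orthogonal to 1, and the self-reversal of P takes care of z^{n+1}
    ([paraorth_opuc_null]). Multiplication by z preserves the form, so modulo P
    it is a unitary operator with characteristic polynomial P. Hence all zeros
    z_j of P lie on the unit circle ([normr1_root_opuc_null]), which gives the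
    equivalence with the Hurwitz condition, and the eigenvectors
    g_j = P / (z - z_j) are pairwise orthogonal ([opuc_dot_cofactor_eq0]).
    Diagonalizing the Gram matrix in this basis gives ([opuc_inverse])

      (C^{-1})_{rs} = sum_j (g_j)_r conj (g_j)_s / <g_j, g_j>.

    When the zeros lie in the right half-plane, each summand has a real part of
    sign (-1)^{r+s}. A real polynomial with all zeros in the right half-plane
    has coefficients of strictly alternating sign, and g_j is either such a
    polynomial (z_j real) or X - conj z_j times one; in the latter case its
    coefficients, after alternating signs, lie in the cone spanned by 1 and
    conj z_j, and any two elements of this cone make an acute angle
    ([Re_cofactor_gt0]). So C^{-1} is strictly checkerboard signed
    ([invmx_toeplitz_checkerboard]), which is the positivity of the minors.

    For the comparison, the eigenvalues of A C^{-1} are positive, and the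
    inequality of arithmetic and geometric means bounds det A / det C by
    (tr (A C^{-1}) / (n+1))^{n+1}. By the two sign patterns every term of
    tr ((C - A) C^{-1}) is nonnegative, and it is positive at each entry where
    A and C differ; therefore tr (A C^{-1}) <= n+1, with equality only for A = C
    ([det_checkerboard_compare]). *)

(** * The Toeplitz form *)

Set Implicit Arguments.
Unset Strict Implicit.
Unset Printing Implicit Defensive.

(** For x = u + iv the mixed terms of the Hermitian form cancel by symmetry,
    leaving the sum of the real forms at u and v. *)
Lemma posdef_complex (R : realType) (m : nat) (T : 'M[R]_m) (x : 'rV[R[i]]_m) :
  posdef T -> x != 0 ->
  0 < (map_mx Num.conj x *m map_mx (real_complex R) T *m x^T) 0 0.
Proof.
move=> [symT posT] x0.
pose u := map_mx (@complex.Re R) x; pose v := map_mx (@complex.Im R) x.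
pose q (y w : 'rV[R]_m) := (y *m T *m w^T) 0 0.
have qC y w : q y w = q w y.
  rewrite /q.
  have -> : w *m T *m y^T = (y *m T *m w^T)^T.
    by rewrite !trmx_mul trmxK symT mulmxA.
  by rewrite [RHS]mxE.
have q_ge0 y : 0 <= q y y.
  have [->|/posT/ltW //] := eqVneq y 0.
  by rewrite /q !mul0mx mxE.
have qE y w : map_mx (real_complex R) y *m map_mx (real_complex R) T *m
    (map_mx (real_complex R) w)^T = (q y w)%:C%:M.
  by rewrite map_trmx -!map_mxM [LHS]mx11_scalar mxE.
have xE : x = map_mx (real_complex R) u + 'i *: map_mx (real_complex R) v.
  by apply/rowP => k; rewrite !mxE -complexE.
have xcE : map_mx Num.conj x =
    map_mx (real_complex R) u - 'i *: map_mx (real_complex R) v.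
  apply/rowP => k; rewrite !mxE; case: (x 0 k) => a b /=.
  by apply/eqP; rewrite eq_complex /=; apply/andP; split; apply/eqP; ring.
have -> : (map_mx Num.conj x *m map_mx (real_complex R) T *m x^T) 0 0 =
    (q u u + q v v)%:C.
  have -> : x^T = (map_mx (real_complex R) u)^T +
      'i *: (map_mx (real_complex R) v)^T by rewrite {1}xE linearD linearZ.
  rewrite xcE !mulmxDl !mulmxDr !mulNmx -!scalemxAl -!scalemxAr.
  rewrite !qE !mxE /= !mulr1n (qC v u) rmorphD /=.
  have := @sqrCi R[i]; move: 'i => j jj.
  by rewrite [X in _ - X]mulrA -expr2 jj; ring.
rewrite ltcR; have [u0|/posT upos] := eqVneq u 0; last by rewrite ltr_wpDr ?q_ge0.
rewrite ltr_wpDl ?q_ge0 //; apply: posT; apply: contraNneq x0 => v0.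
by rewrite xE u0 v0 !map_mx0 scaler0 addr0.
Qed.

Lemma momentZD (R : realType) (c : int -> R) (n : nat) (a : R[i])
    (p q : {poly R[i]}) :
  moment c n (a *: p + q) = a * moment c n p + moment c n q.
Proof.
rewrite /moment mulr_sumr -big_split; apply: eq_bigr => k _ /=.
by rewrite coefD coefZ mulrDl mulrA.
Qed.

Lemma opuc_dotZDr (R : realType) (c : int -> R) (n : nat) (a : R[i])
    (f g h : {poly R[i]}) :
  opuc_dot c n f (a *: g + h) = a * opuc_dot c n f g + opuc_dot c n f h.
Proof. by rewrite /opuc_dot mulrDr -scalerAr momentZD. Qed.

Lemma opuc_dotZDl (R : realType) (c : int -> R) (n : nat) (a : R[i])
    (f g h : {poly R[i]}) :
  opuc_dot c n (a *: f + h) g = a^* * opuc_dot c n f g + opuc_dot c n h g.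
Proof.
rewrite /opuc_dot -momentZD scalerAl -mulrDl; congr (moment _ _ (_ * _)).
apply/polyP => k; rewrite coefD coefZ !coef_poly; case: ifP => _.
  by rewrite coefD coefZ rmorphD rmorphM.
by rewrite mulr0 addr0.
Qed.

Lemma opuc_dotC (R : realType) (c : int -> R) (n : nat) (f g : {poly R[i]}) :
  (forall j, c (- j) = c j) -> (size f <= n.+1)%N -> (size g <= n.+1)%N ->
  opuc_dot c n g f = (opuc_dot c n f g)^*.
Proof.
move=> cE sf sg; rewrite !opuc_dotE // exchange_big rmorph_sum.
apply: eq_bigr => r _; rewrite rmorph_sum; apply: eq_bigr => s _.
rewrite !rmorphM /= conjCK [(_%:C)^*]conjc_real -[c (r%:Z - _)]cE opprB.
by rewrite [(g`_s)^* * _]mulrC.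
Qed.

Lemma opuc_dot_gt0 (R : realType) (c : int -> R) (n : nat) (f : {poly R[i]}) :
  posdef (toeplitz c n.+1) -> (size f <= n.+1)%N -> f != 0 ->
  0 < opuc_dot c n f f.
Proof.
move=> posC sf f0; pose x : 'rV_n.+1 := \row_k f`_k.
have x0 : x != 0.
  apply: contraNneq f0 => /rowP x0; apply/eqP/polyP => k; rewrite coef0.
  have [kn|nk] := ltnP k n.+1; first by have := x0 (Ordinal kn); rewrite !mxE.
  by rewrite nth_default // (leq_trans sf).
have := posdef_complex posC x0; congr (0 < _).
rewrite opuc_dotE // mxE exchange_big; apply: eq_bigr => s _ /=.
rewrite !mxE mulr_suml; apply: eq_bigr => r _.
by rewrite !mxE mulrAC.
Qed.

(** Multiplication by z is an isometry: the Toeplitz entry at (r, s) depends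
    only on r - s. *)
Lemma opuc_dot_mulX (R : realType) (c : int -> R) (n : nat)
    (f g : {poly R[i]}) :
  (size f <= n.+1)%N -> (size g <= n.+1)%N ->
  opuc_dot c n.+1 ('X * f) ('X * g) = opuc_dot c n.+1 f g.
Proof.
have sX (h : {poly R[i]}) : (size h <= n.+1)%N -> (size ('X * h)%R <= n.+2)%N.
  by move=> sh; rewrite (leq_trans (size_polyMleq _ _)) // size_polyX addSn.
move=> sf sg; rewrite [LHS]opuc_dotE ?sX //.
rewrite [RHS]opuc_dotE ?(leqW sf) ?(leqW sg) //.
rewrite [LHS]big_ord_recl [RHS]big_ord_recr /=.
rewrite [X in X + _]big1 => [|s _]; last by rewrite coefXM rmorph0 !mul0r.
rewrite [X in _ = _ + X]big1 => [|s _]; last first.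
  by rewrite (nth_default _ sf) rmorph0 !mul0r.
rewrite add0r addr0; apply: eq_bigr => r _.
rewrite [LHS]big_ord_recl [RHS]big_ord_recr /= !coefXM /=.
rewrite (nth_default _ sg) !mulr0 !mul0r add0r addr0; apply: eq_bigr => s _.
rewrite !coefXM /=; congr (_ * (c _)%:C); rewrite /bump /=; lia.
Qed.

Lemma opuc_dot_succ (R : realType) (c : int -> R) (n : nat)
    (f g : {poly R[i]}) :
  (size f <= n.+1)%N -> (size g <= n.+1)%N ->
  opuc_dot c n.+1 f g = opuc_dot c n f g.
Proof.
move=> sf sg; rewrite [RHS]opuc_dotE // opuc_dotE ?(leqW sf) ?(leqW sg) //.
rewrite big_ord_recr /= [X in _ + X]big1 ?addr0 => [|s _]; last first.
  by rewrite (nth_default _ sf) rmorph0 !mul0r.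
apply: eq_bigr => r _; rewrite big_ord_recr /=.
by rewrite (nth_default _ sg) mulr0 mul0r addr0.
Qed.

(** * Null polynomials and the inverse Toeplitz matrix *)

Definition opuc_null (R : realType) (c : int -> R) (n : nat)
    (P : {poly R[i]}) : Prop :=
  forall f : {poly R[i]}, (size f <= n.+1)%N -> opuc_dot c n f P = 0.

Lemma opuc_nullP (R : realType) (c : int -> R) (n : nat) (P : {poly R[i]}) :
  (size P <= n.+1)%N ->
  (forall k : nat, (k <= n)%N ->
     \sum_(s < n.+1) P`_s * (c (k%:Z - s%:Z))%:C = 0) ->
  opuc_null c n P.
Proof.
move=> sP P0 f sf; rewrite opuc_dotE // big1 // => r _.
under eq_bigr do rewrite -mulrA.
by rewrite -mulr_sumr P0 ?mulr0 // -ltnS.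
Qed.

(** With P = (X - z) g, the isometry X g = z g + P shows that g is an
    eigenvector modulo P: <g, g> = |z|^2 <g, g>. *)
Lemma normr1_root_opuc_null (R : realType) (c : int -> R) (n : nat)
    (P : {poly R[i]}) (z : R[i]) :
  (forall j, c (- j) = c j) -> posdef (toeplitz c n.+1) ->
  size P = n.+2 -> opuc_null c n.+1 P -> root P z -> `|z| = 1.
Proof.
move=> cE posC sP nullP /factor_theorem[g Pg].
have g0 : g != 0 
  by apply: contra_eq_neq sP => /= g0; rewrite Pg g0 mul0r size_poly0.
have sg : size g = n.+1.
  by move: sP; rewrite Pg size_Mmonic ?monicXsubC // size_XsubC addn2 => -[].
have sg1 : (size g <= n.+1)%N by rewrite sg.
have XgE : 'X * g = z *: g + P by rewrite Pg -mul_polyC; ring.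
have sXg : (size ('X * g)%R <= n.+2)%N by rewrite mulrC size_mulX ?sg.
have := opuc_dot_mulX c sg1 sg1.
rewrite {2}XgE opuc_dotZDr (nullP _ sXg) addr0 XgE opuc_dotZDl.
rewrite [opuc_dot _ _ P _]opuc_dotC ?sP ?(leqW sg1) //.
rewrite (nullP _ (leqW sg1)) rmorph0 addr0.
have gg0 : opuc_dot c n.+1 g g != 0.
  by rewrite opuc_dot_succ // gt_eqF // opuc_dot_gt0.
rewrite mulrA -{2}[opuc_dot _ _ _ _]mul1r => /(mulIf gg0).
rewrite -normCK => /eqP; rewrite sqrp_eq1 // => /eqP //.
Qed.

(** Eigenvectors of an isometry are orthogonal. Writing both cofactors through
    the common factor f, instead of dividing by the difference of the
    eigenvalues, also covers a = b; then <g, g> = 0 for the repeated cofactor g,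
    so positivity makes the zeros simple without a separate argument. *)
Lemma opuc_dot_cofactor_eq0 (R : realType) (c : int -> R) (n : nat)
    (f : {poly R[i]}) (a b : R[i]) :
  (size f <= n)%N -> `|b| = 1 ->
  opuc_null c n.+1 (('X - a%:P) * ('X - b%:P) * f) ->
  opuc_dot c n (('X - b%:P) * f) (('X - a%:P) * f) = 0.
Proof.
move=> sf b1 nullP; set g := ('X - a%:P) * f.
have sXsub z : (size (('X - z%:P) * f)%R <= n.+1)%N.
  by rewrite (leq_trans (size_polyMleq _ _)) // size_XsubC addSn.
have sg : (size g <= n.+1)%N := sXsub a.
have sf1 : (size f <= n.+1)%N := leqW sf.
have sXf : (size ('X * f)%R <= n.+1)%N by have := sXsub 0; rewrite subr0.
have bE : b^* * b = 1 by rewrite mulrC -normCK b1 expr1n.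
have XgE : 'X * g = b *: g + ('X - a%:P) * ('X - b%:P) * f.
  by rewrite /g -mul_polyC; ring.
have fg : opuc_dot c n.+1 f g = b * opuc_dot c n.+1 ('X * f) g.
  by rewrite -opuc_dot_mulX // XgE opuc_dotZDr nullP ?addr0 // leqW.
rewrite -opuc_dot_succ ?sXsub //.
have -> : ('X - b%:P) * f = (- b) *: f + 'X * f by rewrite -mul_polyC rmorphN /=; ring.
by rewrite opuc_dotZDl rmorphN fg mulrA mulNr bE mulN1r addNr.
Qed.

(** The rows g_j diagonalize C; inverting the congruence conj G C G^T = D gives
    C^{-1} = G^T D^{-1} conj G. *)
Lemma opuc_inverse (R : realType) (c : int -> R) (n : nat)
    (z : 'I_n.+1 -> R[i]) :
  posdef (toeplitz c n.+1) -> (forall j, `|z j| = 1) ->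
  opuc_null c n.+1 (\prod_j ('X - (z j)%:P)) ->
  let g j := \prod_(i | i != j) ('X - (z i)%:P) in
  forall r s : 'I_n.+1, real_complex R (invmx (toeplitz c n.+1) r s) =
    \sum_j (opuc_dot c n (g j) (g j))^-1 * ((g j)`_r * ((g j)`_s)^*).
Proof.
move=> posC z1 nullP g r s.
pose P : {poly R[i]} := \prod_j ('X - (z j)%:P).
have PE j : P = ('X - (z j)%:P) * g j by rewrite /P (bigD1 j).
have sP : size P = n.+2.
  by rewrite size_prod_XsubC /index_enum -enumT size_enum_ord.
have g0 j : g j != 0.
  apply: contra_eq_neq sP => /= gj0.
  by rewrite (PE j) gj0 mulr0 size_poly0.
have sg j : (size (g j) <= n.+1)%N.
  by move: sP; rewrite (PE j) size_monicM ?monicXsubC // size_XsubC add2n => -[->].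
pose d j := opuc_dot c n (g j) (g j).
have d0 j : d j != 0 by rewrite gt_eqF // opuc_dot_gt0.
have orth j k : j != k -> opuc_dot c n (g j) (g k) = 0.
  move=> jk; pose f := \prod_(i | (i != j) && (i != k)) ('X - (z i)%:P).
  have gj : g j = ('X - (z k)%:P) * f by rewrite /g (bigD1 k) // eq_sym.
  have gk : g k = ('X - (z j)%:P) * f.
    by rewrite /g (bigD1 j) //; under eq_bigl do rewrite andbC.
  rewrite gj gk; apply: opuc_dot_cofactor_eq0 => //.
    have f0 : f != 0 by apply: contra_neq (g0 j); rewrite gj => ->; rewrite mulr0.
    by have := sg j; rewrite gj size_monicM ?monicXsubC // size_XsubC add2n.
  by have := nullP; rewrite -/P (PE j) gj mulrA.
pose C := map_mx (real_complex R) (toeplitz c n.+1).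
pose G := \matrix_(j < n.+1, k < n.+1) (g j)`_k.
have gram : map_mx Num.conj G *m C *m G^T = diag_mx (\row_j d j).
  apply/matrixP => j k; transitivity (opuc_dot c n (g j) (g k)).
    rewrite opuc_dotE // mxE exchange_big; apply: eq_bigr => t _ /=.
    by rewrite !mxE mulr_suml; apply: eq_bigr => i _; rewrite !mxE mulrAC.
  rewrite !mxE; have [->|/orth ->] := eqVneq j k; by rewrite ?mulr1n ?mulr0n.
pose D := diag_mx (\row_j (d j)^-1).
have left_inv : map_mx Num.conj G *m (C *m G^T *m D) = 1%:M.
  rewrite !mulmxA gram mulmx_diag; apply/matrixP => j k.
  by rewrite !mxE mulfV ?d0.
have right_inv : C *m (G^T *m D *m map_mx Num.conj G) = 1%:M.
  by rewrite !mulmxA; apply: mulmx1C.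
have invC : invmx C = G^T *m D *m map_mx Num.conj G.
  have [uC _] := mulmx1_unit right_inv.
  by rewrite -[RHS]mul1mx -(mulVmx uC) -[RHS]mulmxA right_inv mulmx1.
transitivity (invmx C r s); first by rewrite -map_invmx mxE.
rewrite invC mxE; apply: eq_bigr => j _.
by rewrite mul_mx_diag !mxE -mulrA mulrCA.
Qed.

(** * Coefficient signs of polynomials with zeros in the right half-plane *)

(** Positivity of all coefficients of (-1)^d f(-z). *)
Definition alternating (R : realType) (d : nat) (f : {poly R}) : Prop :=
  size f = d.+1 /\
  forall k : nat, (k <= d)%N -> 0 < (-1) ^+ (d + k) * f`_k.

Lemma alternating_ge0 (R : realType) (d : nat) (f : {poly R}) (k : nat) :
  alternating d f -> 0 <= (-1) ^+ (d + k) * f`_k.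
Proof.
move=> [sf altf]; have [kd|dk] := leqP k d; first by rewrite ltW ?altf.
by rewrite nth_default ?mulr0 // sf.
Qed.

Lemma alternatingM (R : realType) (d e : nat) (f g : {poly R}) :
  alternating d f -> alternating e g -> alternating (d + e) (f * g).
Proof.
move=> altf altg; have [sf posf] := altf; have [sg posg] := altg.
have f0 : f != 0 by rewrite -size_poly_eq0 sf.
have g0 : g != 0 by rewrite -size_poly_eq0 sg.
split=> [|k kde]; first by rewrite size_mul // sf sg addnS addSn.
have signE (i : 'I_k.+1) : (-1) ^+ (d + e + k) * (f`_i * g`_(k - i)) =
    ((-1) ^+ (d + i) * f`_i) * ((-1) ^+ (e + (k - i)) * g`_(k - i)).
  have -> : (d + e + k = (d + i) + (e + (k - i)))%N.
    by have := ltn_ord i; lia.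
  by rewrite (exprD _ (d + i)); ring.
have mk : (minn k d < k.+1)%N by rewrite ltnS geq_minl.
rewrite coefM mulr_sumr (bigD1 (Ordinal mk)) //= ltr_wpDr //.
  apply: sumr_ge0 => i _; rewrite signE mulr_ge0 //; exact: alternating_ge0.
by rewrite (signE (Ordinal mk)) mulr_gt0 //= ?posf ?posg ?geq_minr //; lia.
Qed.

Lemma alternating_XsubC (R : realType) (a : R) :
  0 < a -> alternating 1 ('X - a%:P).
Proof.
move=> a0; split=> [|[|[|//]] _]; first by rewrite size_XsubC.
  by rewrite coefB coefX coefC /= expr1; lra.
by rewrite coefB coefX coefC /= sqrrN expr1n; lra.
Qed.

Definition conj_quadratic (R : realType) (z : R[i]) : {poly R} :=
  'X^2 - (2 * complex.Re z) *: 'X + (complex.Re z ^+ 2 + complex.Im z ^+ 2)%:P.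

Lemma coef_conj_quadratic (R : realType) (z : R[i]) (k : nat) :
  (conj_quadratic z)`_k = [:: complex.Re z ^+ 2 + complex.Im z ^+ 2;
                              - (2 * complex.Re z); 1]`_k.
Proof.
rewrite coefD coefB coefZ coefXn coefX coefC.
by case: k => [|[|[|k]]] /=; rewrite ?nth_nil; ring.
Qed.

Lemma size_conj_quadratic (R : realType) (z : R[i]) :
  size (conj_quadratic z) = 3%N.
Proof.
apply/anti_leq/andP; split.
  by apply/leq_sizeP => -[|[|[|k]]] //= _; rewrite coef_conj_quadratic /= nth_nil.
rewrite ltnNge; apply/negP => /leq_sizeP/(_ 2 isT)/eqP.
by rewrite coef_conj_quadratic oner_eq0.
Qed.

Lemma map_conj_quadratic (R : realType) (z : R[i]) :
  map_poly (real_complex R) (conj_quadratic z) =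
    ('X - z%:P) * ('X - (z^*)%:P).
Proof.
rewrite /conj_quadratic rmorphD rmorphB /= map_polyXn map_polyZ map_polyX.
rewrite map_polyC /= add_Re2_Im2 normCK -mul_polyC polyCM.
rewrite rmorphM /= rmorph_nat -addcJ polyCD.
rewrite -[z^*%C]/(z^*); ring.
Qed.

Lemma alternating_conj_quadratic (R : realType) (z : R[i]) :
  0 < complex.Re z -> alternating 2 (conj_quadratic z).
Proof.
move=> z0; split=> [|k k2]; first exact: size_conj_quadratic.
rewrite coef_conj_quadratic; case: k k2 => [|[|[|//]]] _ /=.
- by rewrite sqrrN expr1n mul1r ltr_wpDr ?sqr_ge0 // exprn_gt0.
- by rewrite addn1 exprS sqrrN expr1n; lra.
- by rewrite -signr_odd /= mul1r ltr01.
Qed.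

(** The remainder is a real polynomial of degree at most 1 with a nonreal
    zero. *)
Lemma dvdp_conj_quadratic (R : realType) (f : {poly R}) (z : R[i]) :
  complex.Im z != 0 -> root (map_poly (real_complex R) f) z ->
  conj_quadratic z %| f.
Proof.
case: z => x y /= y0; set z := x +i* y => fz; set q := conj_quadratic z.
have q0 : q != 0 by rewrite -size_poly_eq0 size_conj_quadratic.
have sr : (size (f %% q)%R <= 2)%N.
  by have := ltn_modp f q; rewrite q0 size_conj_quadratic ltnS.
have qz : (map_poly (real_complex R) q).[z] = 0.
  by rewrite map_conj_quadratic hornerM hornerXsubC subrr mul0r.
have : (map_poly (real_complex R) (f %% q)).[z] = 0.
  have := fz; rewrite {1}(divp_eq f q) rmorphD rmorphM /root /= hornerD hornerM.
  by rewrite qz mulr0 add0r => /eqP.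
rewrite (horner_coef_wide z (n := 2)) ?size_map_poly // !big_ord_recl big_ord0.
rewrite !coef_map /= expr0 mulr1 addr0 expr1.
move=> /eqP.
rewrite eq_complex /= => /andP[/eqP re0 /eqP im0].
have r1 : (f %% q)`_1 = 0.
  apply/eqP; move: im0; rewrite !(mul0r, addr0, add0r) => /eqP.
  by rewrite mulf_eq0 (negPf y0) orbF.
have r0 : (f %% q)`_0 = 0 by move: re0; rewrite r1 !(mul0r, addr0, subr0, oppr0).
rewrite /dvdp; apply/eqP/polyP => -[|[|k]]; rewrite ?coef0 //.
by rewrite nth_default // (leq_trans sr).
Qed.

(** Stodola's coefficient criterion: splitting off real linear and quadratic
    factors, each of which alternates, reduces to products. *)
Lemma alternating_right_half_plane (R : realType) (d : nat) (f : {poly R}) :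
  size f = d.+1 -> f \is monic ->
  (forall z, root (map_poly (real_complex R) f) z -> 0 < complex.Re z) ->
  alternating d f.
Proof.
elim/ltn_ind: d f => -[|d] IH f sf mf fpos.
  split=> // -[|//] _; rewrite expr0 mul1r.
  by move: mf; rewrite monicE /lead_coef sf => /eqP ->; rewrite ltr01.
have [z fz] : exists z, root (map_poly (real_complex R) f) z.
  by apply/closed_rootP; rewrite size_map_poly sf.
have z0 := fpos z fz.
have step e (q h : {poly R}) : f = h * q -> q \is monic -> alternating e.+1 q ->
    (e <= d)%N -> alternating d.+1 f.
  move=> fE mq altq ed; have [sq _] := altq.
  have mh : h \is monic by rewrite -(monicMr h mq) -fE.
  have sh : size h = (d - e).+1.
    by have := sf; rewrite fE size_Mmonic ?monic_neq0 // sq; lia.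
  have -> : d.+1 = (d - e + e.+1)%N by lia.
  rewrite fE; apply: alternatingM => //; apply: IH => //; first by lia.
  by move=> w hw; apply: fpos; rewrite fE rmorphM rootM hw.
have [z1|z1] := eqVneq (complex.Im z) 0.
  have fa : root f (complex.Re z).
    have zE : z = (complex.Re z)%:C by move: z1; case: (z) => x y /= ->.
    by rewrite -(fmorph_root (real_complex R)) /= -zE.
  have [h fE] := factor_theorem _ _ fa.
  by apply: (step 0%N _ h fE); rewrite ?monicXsubC //; apply: alternating_XsubC.
have /dvdpP[h fE] := dvdp_conj_quadratic z1 fz.
have mq : conj_quadratic z \is monic.
  by rewrite monicE /lead_coef size_conj_quadratic coef_conj_quadratic.
have d0 : (0 < d)%N.
  have h0 : h != 0.
    by apply: contra_eq_neq sf => /= h0; rewrite fE h0 mul0r size_poly0.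
  have := sf; rewrite fE size_Mmonic // size_conj_quadratic.
  by rewrite addn3 => -[<-]; rewrite size_poly_gt0.
apply: (step 1%N _ h fE) => //; exact: alternating_conj_quadratic.
Qed.

(** The cofactor g of a real zero is real and alternates. Otherwise
    g = (X - conj z) h with h real and alternating, so that, up to a global
    sign, (-1)^k g_k = U_k + conj z V_k with U_k, V_k >= 0. The real part of
    (U_r + conj z V_r) (U_s + z V_s) is a sum of nonnegative terms; U vanishes
    only at k = 0 and V only at k = n, so one term is positive. *)
Lemma Re_cofactor_gt0 (R : realType) (n : nat) (p : {poly R})
    (g : {poly R[i]}) (z : R[i]) (r s : nat) :
  size p = n.+2 -> p \is monic ->
  (forall w, root (map_poly (real_complex R) p) w -> 0 < complex.Re w) ->
  map_poly (real_complex R) p = ('X - z%:P) * g ->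
  (r <= n)%N -> (s <= n)%N ->
  0 < complex.Re ((-1) ^+ (r + s) * (g`_r * (g`_s)^*)).
Proof.
move=> sp mp ppos pE rn sn.
have pz : root (map_poly (real_complex R) p) z by rewrite pE rootM root_XsubC eqxx.
have z0 := ppos z pz.
have XzI := mulfI (monic_neq0 (monicXsubC z)).
have hpos (h q : {poly R}) : p = h * q ->
    forall w, root (map_poly (real_complex R) h) w -> 0 < complex.Re w.
  by move=> hE w hw; apply: ppos; rewrite hE rmorphM rootM hw.
have signM d k l (x y : R) :
    (-1) ^+ (d + k) * x * ((-1) ^+ (d + l) * y) = (-1) ^+ (k + l) * (x * y).
  rewrite !exprD -[RHS]mul1r -[X in _ = X * _](sqrr_sign R d); ring.
have signC k : (-1) ^+ k = ((-1) ^+ k)%:C :> R[i] by rewrite rmorph_sign.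
have [z1|z1] := eqVneq (complex.Im z) 0.
  have zE : z = (complex.Re z)%:C by move: z1; case: (z) => x y /= ->.
  have [h hE] : exists h, p = h * ('X - (complex.Re z)%:P).
    apply: factor_theorem.
    by rewrite -(fmorph_root (real_complex R)) /= -zE.
  have gE : g = map_poly (real_complex R) h.
    apply: XzI; rewrite -pE hE rmorphM rmorphB /= map_polyX map_polyC /= -zE.
    by rewrite mulrC.
  have mh : h \is monic.
    by rewrite -(monicMr h (monicXsubC (complex.Re z))) -hE.
  have sh : size h = n.+1.
    have := sp; rewrite hE size_Mmonic ?monicXsubC ?monic_neq0 //.
    by rewrite size_XsubC addn2 => -[].
  have [_ alth] := alternating_right_half_plane sh mh (hpos _ _ hE).
  rewrite gE !coef_map /= signC; have := mulr_gt0 (alth r rn) (alth s sn).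
  by rewrite signM /=; congr (0 < _); ring.
have /dvdpP[h hE] := dvdp_conj_quadratic z1 pz.
have gE : g = ('X - (z^*)%:P) * map_poly (real_complex R) h.
  by apply: XzI; rewrite -pE hE rmorphM /= map_conj_quadratic; ring.
have mq : conj_quadratic z \is monic.
  by rewrite monicE /lead_coef size_conj_quadratic coef_conj_quadratic.
have mh : h \is monic by rewrite -(monicMr h mq) -hE.
have sh : size h = n.
  by have := sp; rewrite hE size_Mmonic ?monic_neq0 // size_conj_quadratic addn3 => -[].
case: n => [|d] in sp rn sn sh *.
  by move: mh; rewrite monicE lead_coefE sh nth_default ?sh // eq_sym oner_eq0.
have alth := alternating_right_half_plane sh mh (hpos _ _ hE).
(* U and V before the change of sign. *)
pose u k := ('X * h)`_k; pose v k := h`_k.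
have u_gt0 k : (0 < k <= d.+1)%N -> 0 < (-1) ^+ (d.+1 + k) * u k.
  case: k => // k /= kd; rewrite /u coefXM /= addSn addnS.
  by rewrite !exprS !mulN1r opprK; apply: alth.2.
have v_gt0 k : (k <= d)%N -> 0 < (-1) ^+ (d + k) * v k by apply: alth.2.
have u_ge0 k : 0 <= (-1) ^+ (d.+1 + k) * u k.
  case: k => [|k]; first by rewrite /u coefXM mulr0.
  by rewrite /u coefXM /= addSn addnS !exprS !mulN1r opprK alternating_ge0.
have v_ge0 k : 0 <= (-1) ^+ (d + k) * v k by apply: alternating_ge0.
have gkE k : g`_k = (u k)%:C - z^* * (v k)%:C.
  rewrite gE mulrBl coefB coefCM coefXM coef_map /u coefXM.
  by case: k => [|k]; rewrite ?rmorph0 //= coef_map.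
have -> : complex.Re ((-1) ^+ (r + s) * (g`_r * (g`_s)^*)) =
    (-1) ^+ (r + s) * (u r * u s)
    + (complex.Re z ^+ 2 + complex.Im z ^+ 2) * ((-1) ^+ (r + s) * (v r * v s))
    + complex.Re z * (- ((-1) ^+ (r + s) * (u r * v s))
                      - (-1) ^+ (r + s) * (v r * u s)).
  rewrite signC !gkE; move: ((-1) ^+ (r + s)) (u r) (u s) (v r) (v s).
  by case: (z) => x y /= *; ring.
have uvE k l : - ((-1) ^+ (k + l) * (u k * v l)) =
    (-1) ^+ (d.+1 + k) * u k * ((-1) ^+ (d + l) * v l).
  by rewrite -(signM d) addSn exprS; ring.
rewrite [v r * u s]mulrC (addnC r s) uvE (addnC s r) uvE.
rewrite -(signM d.+1 r s) -(signM d r s).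
have N0 : 0 < complex.Re z ^+ 2 + complex.Im z ^+ 2.
  by rewrite ltr_wpDr ?sqr_ge0 // exprn_gt0.
pose U k := (-1) ^+ (d.+1 + k) * u k; pose V k := (-1) ^+ (d + k) * v k.
rewrite -/(U r) -/(U s) -/(V r) -/(V s).
have UU : 0 <= U r * U s by rewrite mulr_ge0 ?u_ge0.
have VV : 0 <= V r * V s by rewrite mulr_ge0 ?v_ge0.
have UV : 0 <= U r * V s by rewrite mulr_ge0 ?u_ge0 ?v_ge0.
have VU : 0 <= U s * V r by rewrite mulr_ge0 ?u_ge0 ?v_ge0.
have [/andP[rd sd]|] := boolP ((r <= d) && (s <= d))%N.
  apply: ltr_wpDr; first by rewrite mulr_ge0 ?(ltW z0) ?addr_ge0.
  by apply: ltr_wpDl => //; apply: mulr_gt0 => //; apply: mulr_gt0; apply: v_gt0.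
have [/andP[r0 s0] _|rs0 rsd] := boolP ((0 < r) && (0 < s))%N.
  apply: ltr_wpDr; first by rewrite mulr_ge0 ?(ltW z0) ?addr_ge0.
  apply: ltr_wpDr; first by rewrite mulr_ge0 ?(ltW N0).
  by apply: mulr_gt0; apply: u_gt0; rewrite ?r0 ?s0.
apply: ltr_wpDl; first by rewrite addr_ge0 // mulr_ge0 // ltW.
apply: mulr_gt0 => //; have [r0|r0] := posnP r.
  by apply: ltr_wpDl => //; apply: mulr_gt0; [apply: u_gt0|apply: v_gt0]; lia.
by apply: ltr_wpDr => //; apply: mulr_gt0; [apply: u_gt0|apply: v_gt0]; lia.
Qed.

(** * The checkerboard sign pattern of the inverse *)

(** Each summand of [opuc_inverse] contributes a positive multiple of a number
    to which [Re_cofactor_gt0] applies. *)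
Lemma invmx_toeplitz_checkerboard (R : realType) (c : int -> R) (n : nat)
    (p : {poly R}) :
  (forall j, c (- j) = c j) -> posdef (toeplitz c n.+1) ->
  size p = n.+2 -> p \is monic ->
  opuc_null c n.+1 (map_poly (real_complex R) p) ->
  (forall z, root (map_poly (real_complex R) p) z -> 0 < complex.Re z) ->
  forall r s : 'I_n.+1, 0 < (-1) ^+ (r + s) * invmx (toeplitz c n.+1) r s.
Proof.
move=> cE posC sp mp nullp pos r s; set P := map_poly (real_complex R) p.
have sP : size P = n.+2 by rewrite size_map_poly.
have [zs Pzs] := closed_field_poly_normal P.
move: Pzs; rewrite (monicP _) ?map_monic // scale1r => Pzs.
have szs : size zs = n.+1 by move: sP; rewrite Pzs size_prod_XsubC => -[].
pose z (j : 'I_n.+1) := zs`_j.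
have PE : P = \prod_j ('X - (z j)%:P).
  by rewrite Pzs (big_nth 0) szs big_mkord.
pose g j := \prod_(i | i != j) ('X - (z i)%:P).
have Pg j : P = ('X - (z j)%:P) * g j by rewrite PE (bigD1 j).
have z1 j : `|z j| = 1.
  apply: (normr1_root_opuc_null cE posC sP nullp).
  by rewrite (Pg j) rootM root_XsubC eqxx.
pose d j := opuc_dot c n (g j) (g j).
have nullP : opuc_null c n.+1 (\prod_j ('X - (z j)%:P)) by rewrite -PE.
move: (invmx _ r s) (opuc_inverse posC z1 nullP r s) => S invE.
have sg j : size (g j) = n.+1.
  have gj0 : g j != 0.
    by apply: contra_eq_neq sP => /= g0; rewrite (Pg j) g0 mulr0 size_poly0.
  move: sP; rewrite (Pg j) size_monicM ?monicXsubC //.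
  by rewrite size_XsubC add2n => -[].
have dE j : (d j)^-1 = (complex.Re (d j)^-1)%:C.
  rewrite RRe_real // gtr0_real // invr_gt0 opuc_dot_gt0 ?sg //.
  by rewrite -size_poly_gt0 sg.
have d_gt0 j : 0 < complex.Re (d j)^-1.
  rewrite -ltcR -dE invr_gt0 opuc_dot_gt0 ?sg //.
  by rewrite -size_poly_gt0 sg.
have ReD : {morph @complex.Re R : x y / x + y} by case=> ? ? [].
have -> : (-1) ^+ (r + s) * S =
    \sum_j complex.Re (d j)^-1 *
      complex.Re ((-1) ^+ (r + s) * ((g j)`_r * ((g j)`_s)^*)).
  have -> : (-1) ^+ (r + s) * S = complex.Re (\sum_j (d j)^-1 *
      ((-1) ^+ (r + s) * ((g j)`_r * ((g j)`_s)^*))).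
    under eq_bigr do rewrite mulrCA.
    by rewrite -mulr_sumr -invE -(rmorph_sign (real_complex R)) -rmorphM.
  rewrite (big_morph _ ReD (erefl : complex.Re (0 : R[i]) = 0)).
  apply: eq_bigr => j _; rewrite dE /=.
  by case: (X in complex.Re (_ * X)) => x y /=; rewrite mul0r subr0.
have term_gt0 j : 0 < complex.Re (d j)^-1 *
      complex.Re ((-1) ^+ (r + s) * ((g j)`_r * ((g j)`_s)^*)).
  apply: mulr_gt0 => //; apply: (Re_cofactor_gt0 sp mp pos (Pg j)).
    by rewrite -ltnS.
  by rewrite -ltnS.
by rewrite (bigD1 ord0) //= ltr_wpDr // sumr_ge0 // => j _; rewrite ltW.
Qed.

(** * Determinant comparison *)

Lemma posdef_unitmx (R : realType) (m : nat) (B : 'M[R]_m) :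
  posdef B -> B \in unitmx.
Proof.
move=> [_ posB]; rewrite unitmxE unitfE; apply/negP => /det0P[v v0 vB].
by have := posB v v0; rewrite vB mul0mx mxE ltxx.
Qed.

Lemma posdef1 (R : realType) (m : nat) : posdef (1%:M : 'M[R]_m).
Proof.
split=> [|x x0]; first exact: trmx1.
rewrite mulmx1 mxE; have /rV0Pn[k xk] := x0.
rewrite (bigD1 k) //= ltr_wpDr //.
  by apply: sumr_ge0 => i _; rewrite mxE -expr2 sqr_ge0.
by rewrite mxE -expr2 exprn_even_gt0.
Qed.

(** An eigenvalue lambda of A B^-1 with row eigenvector v satisfies
    v A = lambda v B, hence is a quotient of two positive numbers. *)
Lemma posdef_pencil_eigenvalues (R : realType) (n : nat) (A B : 'M[R]_n.+1) :
  posdef A -> posdef B ->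
  exists l : 'I_n.+1 -> R, [/\ forall i, 0 < l i,
    \det (A *m invmx B) = \prod_i l i & \tr (A *m invmx B) = \sum_i l i].
Proof.
move=> posA posB; have uB := posdef_unitmx posB.
pose M := map_mx (real_complex R) (A *m invmx B).
have [ls charE] := closed_field_poly_normal (char_poly M).
move: charE; rewrite (monicP (char_poly_monic M)) scale1r => charE.
have sls : size ls = n.+1.
  by have := size_char_poly M; rewrite charE size_prod_XsubC => -[].
have ls_gt0 x : x \in ls -> 0 < x.
  rewrite -root_prod_XsubC -charE -eigenvalue_root_char => /eigenvalueP[v vM v0].
  have vAB : v *m map_mx (real_complex R) A = x *: (v *m map_mx (real_complex R) B).
    rewrite scalemxAl -vM -mulmxA -map_mxM /= -mulmxA mulVmx //.
    by rewrite mulmx1.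
  pose w := map_mx Num.conj v.
  have wK : map_mx Num.conj w = v.
    by apply/rowP => k; rewrite !mxE conjCK.
  have w0 : w != 0 by apply: contraNneq v0 => w0; rewrite -wK w0 map_mx0.
  have := posdef_complex posA w0; have := posdef_complex posB w0.
  rewrite wK vAB -scalemxAl => B0; rewrite mxE.
  by rewrite pmulr_lgt0.
pose l (i : 'I_n.+1) := complex.Re ls`_i.
have lE (i : 'I_n.+1) : (l i)%:C = ls`_i.
  by rewrite RRe_real // gtr0_real // ls_gt0 // mem_nth // sls.
exists l; split=> [i||].
- by rewrite -ltcR lE ls_gt0 // mem_nth // sls.
- apply: (@complexI R); rewrite rmorph_prod -det_map_mx -/M.
  have := coef0_prod_XsubC ls; rewrite -charE char_poly_det sls.
  move/(can_inj (signrMK _)) => ->.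
  by rewrite (big_nth 0) sls big_mkord; apply: eq_bigr => i _; apply: esym (lE i).
- apply: (@complexI R); rewrite [RHS]rmorph_sum -trace_map_mx -/M.
  have := @coefPn_prod_XsubC _ ls; rewrite -charE sls => /(_ isT).
  rewrite char_poly_trace // => /oppr_inj ->.
  by rewrite (big_nth 0) sls big_mkord; apply: eq_bigr => i _; apply: esym (lE i).
Qed.

Lemma posdef_det_gt0 (R : realType) (n : nat) (A : 'M[R]_n.+1) :
  posdef A -> 0 < \det A.
Proof.
move=> /posdef_pencil_eigenvalues/(_ (posdef1 _ _))[l [l_gt0 detE _]].
by rewrite -[A]mulmx1 -[1%:M]invmx1 detE prodr_gt0.
Qed.

(** The inequality of arithmetic and geometric means for the eigenvalues of
    A B^{-1}. *)
Lemma det_le_trace (R : realType) (n : nat) (A B : 'M[R]_n.+1) :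
  posdef A -> posdef B ->
  0 <= \tr (A *m invmx B) /\
  \det A <= \det B * (\tr (A *m invmx B) / n.+1%:R) ^+ n.+1.
Proof.
move=> posA posB; have detB := posdef_det_gt0 posB.
have [l [l_gt0 detE trE]] := posdef_pencil_eigenvalues posA posB.
split; first by rewrite trE sumr_ge0 // => i _; rewrite ltW.
have -> : \det A = \det B * \det (A *m invmx B).
  by rewrite det_mulmx det_inv mulrCA mulfV ?mulr1 // gt_eqF.
rewrite ler_pM2l // detE trE.
have [] := @leif_AGM _ _ 'I_n.+1 l; first by move=> i _; rewrite ltW.
by rewrite card_ord.
Qed.

(** The signs make every term of tr ((B - A) B^{-1}) nonnegative. Equality of
    the determinants forces this trace to vanish, hence all its terms, and
    B^{-1} has no zero entry. *)
Lemma det_checkerboard_compare (R : realType) (n : nat) (A B : 'M[R]_n.+1) :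
  posdef A -> posdef B ->
  (forall r s : 'I_n.+1, 0 < (-1) ^+ (r + s) * invmx B r s) ->
  (forall r s : 'I_n.+1, 0 <= (-1) ^+ (r + s) * (B r s - A r s)) ->
  \det A <= \det B /\ (\det A = \det B <-> A = B).
Proof.
move=> posA posB invB AB; have detB := posdef_det_gt0 posB.
have [tr_ge0 det_le] := det_le_trace posA posB.
pose t (r s : 'I_n.+1) := (B r s - A r s) * invmx B s r.
have tE r s : t r s =
    ((-1) ^+ (r + s) * (B r s - A r s)) * ((-1) ^+ (s + r) * invmx B s r).
  by rewrite mulrACA (addnC s r) -expr2 sqrr_sign mul1r.
have t_ge0 r s : 0 <= t r s by rewrite tE mulr_ge0 ?AB ?ltW ?invB.
have trE : \tr (A *m invmx B) = n.+1%:R - \sum_r \sum_s t r s.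
  rewrite -[n.+1%:R](mxtrace1 R) -(mulmxV (posdef_unitmx posB)).
  apply/eqP; rewrite eq_sym subr_eq addrC -subr_eq -linearB /= -mulmxBl; apply/eqP.
  by apply: eq_bigr => r _; rewrite mxE; apply: eq_bigr => s _; rewrite !mxE.
have sum_ge0 : 0 <= \sum_r \sum_s t r s.
  by apply: sumr_ge0 => r _; apply: sumr_ge0.
have n_gt0 : 0 < n.+1%:R :> R by rewrite ltr0Sn.
split=> [|].
  rewrite (le_trans det_le) // -[leRHS]mulr1 ler_pM2l // exprn_ile1 //.
    by rewrite divr_ge0 // ltW.
  by rewrite ler_pdivrMr // mul1r trE gerBl.
split=> [detAB|->//].
have sum0 : \sum_r \sum_s t r s = 0.
  apply/eqP; rewrite eq_le sum_ge0 andbT leNgt; apply/negP => sum_gt0.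
  have : \det A < \det B; last by rewrite detAB ltxx.
  rewrite (le_lt_trans det_le) // -[ltRHS]mulr1 ltr_pM2l // exprn_ilt1 //.
    by rewrite divr_ge0 // ltW.
  by rewrite ltr_pdivrMr // mul1r trE gtrBl.
apply/matrixP => r s; apply/eqP; rewrite eq_sym -subr_eq0.
have row0 : \sum_s t r s = 0.
  by apply: (psumr_eq0P _ sum0) => // i _; apply: sumr_ge0.
have := psumr_eq0P (fun i _ => t_ge0 r i) row0 (i := s) isT.
rewrite /t => /eqP; rewrite mulf_eq0 => /orP[//|/eqP S0].
by have := invB s r; rewrite S0 mulr0 ltxx.
Qed.

(** * The paraorthogonal polynomial *)

(** The moments being real, the conjugate of Q has the same defining properties,
    so uniqueness applies. *)
Lemma monic_orthogonal_real (R : realType) (c : int -> R) (n : nat)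
    (Q : {poly R[i]}) :
  posdef (toeplitz c n.+1) -> monic_orthogonal c n Q ->
  exists q : {poly R}, Q = map_poly (real_complex R) q.
Proof.
move=> posC orthQ; have [sQ mQ oQ] := orthQ.
have orthQc : monic_orthogonal c n (map_poly Num.conj Q).
  split; rewrite ?size_map_poly ?map_monic // => k kn.
  rewrite opuc_dotXE ?size_map_poly ?sQ ?(ltnW kn) //.
  have := oQ k kn; rewrite opuc_dotXE ?sQ ?(ltnW kn) // => /(congr1 Num.conj).
  rewrite rmorph0 rmorph_sum => E; rewrite -[RHS]E; apply: eq_bigr => s _.
  by rewrite rmorphM coef_map /= [X in _ = _ * X]conjc_real.
have QcE := monic_orthogonal_uniq posC orthQ orthQc.
exists (\poly_(k < n.+1) complex.Re Q`_k).
apply/polyP => k; rewrite coef_map coef_poly /=.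
case: ltnP => [_|nk]; last by rewrite nth_default // sQ.
rewrite RRe_real // CrealE; apply/eqP.
by rewrite {2}QcE coef_map.
Qed.

Lemma even_seq_abs (R : realType) (c : int -> R) (n : nat) (j : int) :
  (forall k : nat, (k <= n)%N -> c (- k%:Z) = c k%:Z) -> (`|j| <= n)%N ->
  c j = c `|j|%N.
Proof.
move=> cE; case: j => k //= kn.
by rewrite NegzE cE.
Qed.

(** The extra moment c_{n+1} is chosen to make P orthogonal to 1; P is
    orthogonal to z, ..., z^n because Q and its reversal are, and to z^{n+1}
    because P is self-reversed up to sign. *)
Lemma paraorth_opuc_null (R : realType) (c : int -> R) (n : nat)
    (Q : {poly R[i]}) :
  (forall j : nat, (j <= n)%N -> c (- j%:Z) = c j%:Z) ->
  posdef (toeplitz c n.+1) -> monic_orthogonal c n Q ->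
  exists (c' : int -> R) (p : {poly R}),
    [/\ forall j, c' (- j) = c' j, toeplitz c' n.+1 = toeplitz c n.+1,
        size p = n.+2 /\ p \is monic,
        paraorth n Q = map_poly (real_complex R) p &
        opuc_null c' n.+1 (paraorth n Q)].
Proof.
move=> cE posC orthQ; have [sQ mQ oQ] := orthQ.
have [q QE] := monic_orthogonal_real posC orthQ.
have sq : size q = n.+1 by rewrite -sQ QE size_map_poly.
have qn : q`_n = 1.
  by move: mQ; rewrite QE map_monic monicE /lead_coef sq => /eqP.
have oq k : (k < n)%N -> \sum_(s < n.+1) q`_s * c (k%:Z - s%:Z) = 0.
  move=> kn; apply: (@complexI R); rewrite rmorph_sum -[RHS](oQ k kn).
  rewrite opuc_dotXE ?sQ ?(ltnW kn) //; apply: eq_bigr => s _.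
  by rewrite rmorphM QE coef_map.
pose rq := \poly_(k < n.+1) q`_(n - k).
pose p := 'X * q - (-1) ^+ n *: rq.
have pk k : p`_k = ('X * q)`_k - (-1) ^+ n * rq`_k by rewrite coefB coefZ.
have pE : paraorth n Q = map_poly (real_complex R) p.
  rewrite /paraorth QE rmorphB rmorphM /= map_polyX map_polyZ /= rmorph_sign.
  congr (_ - _ *: _); apply/polyP => k; rewrite coef_map.
  rewrite [rq`_k]coef_poly [LHS]coef_poly /=.
  by case: ifP => // _; rewrite coef_map /= [LHS]conjc_real.
have pn1 : p`_n.+1 = 1.
  by rewrite pk coefXM /= coef_poly ltnn mulr0 subr0.
have sp : size p = n.+2.
  apply/anti_leq/andP; split; last first.
    rewrite ltnNge; apply/negP => /leq_sizeP/(_ n.+1 (leqnn _)) /eqP.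
    by rewrite pn1 oner_eq0.
  apply/leq_sizeP => k nk; rewrite pk coefXM coef_poly !ifF; try lia.
  by rewrite nth_default ?mulr0 ?subr0 // sq; lia.
have mp : p \is monic by rewrite monicE /lead_coef sp pn1.
(* Self-reversal of P. *)
have psym k : (k <= n.+1)%N -> p`_(n.+1 - k) = - (-1) ^+ n * p`_k.
  have ee : (-1) ^+ n * (-1) ^+ n = 1 :> R by rewrite -expr2 sqrr_sign.
  case: k => [_|k]; rewrite !pk !coefXM !coef_poly ?subn0 ?subSS /=.
    by rewrite ltnn qn !mulr0 !subr0 sub0r mulNr mulrN opprK mulr1 ee.
  rewrite ltnS => kn; rewrite subKn //.
  have -> : (n - k < n.+1)%N by lia.
  rewrite mulrBr [X in _ = _ - X]mulrA [X in _ = _ - X * _]mulNr ee.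
  case: (ltngtP k n) kn => // [kn|kn] _.
    have -> : (n - k == 0)%N = false by lia.
    have -> : (k.+1 < n.+1)%N by lia.
    have -> : (n - k.+1 = (n - k).-1)%N by lia.
    by ring.
  by rewrite kn subnn eqxx ltnn; ring.
pose x := - \sum_(s < n.+1) p`_s * c s%:Z.
pose c' (j : int) := if (`|j| <= n)%N then c `|j|%N else x.
have c'E j : (`|j| <= n)%N -> c' j = c j.
  by move=> jn; rewrite /c' jn -(even_seq_abs cE jn).
have c'even j : c' (- j) = c' j by rewrite /c' abszN.
exists c', p; split=> //.
  apply/matrixP => r s; rewrite !mxE c'E //.
  by have := ltn_ord r; have := ltn_ord s; lia.
rewrite pE; apply: opuc_nullP => [|k kn]; first by rewrite size_map_poly sp.
suff null0 : \sum_(s < n.+2) p`_s * c' (k%:Z - s%:Z) = 0.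
  rewrite -[RHS](rmorph0 (real_complex R)) -null0 rmorph_sum.
  by apply: eq_bigr => s _; rewrite rmorphM coef_map.
have null_const : \sum_(s < n.+2) p`_s * c' (0 - s%:Z) = 0.
  rewrite big_ord_recr /= pn1 mul1r {2}/c' ifF; last by lia.
  rewrite /x; apply/eqP; rewrite subr_eq0; apply/eqP; apply: eq_bigr => s _.
  rewrite sub0r c'even c'E //.
  by have := ltn_ord s; lia.
case: k kn => [|k] kn; first exact: null_const.
have [kn'|kn'] := ltnP k n; last first.
  have -> : k = n by lia.
  rewrite (reindex_inj rev_ord_inj) /=.
  transitivity (- (-1) ^+ n * \sum_(s < n.+2) p`_s * c' (0 - s%:Z)).
    rewrite mulr_sumr; apply: eq_bigr => s _.
    have sn := ltn_ord s; rewrite subSS psym // mulrA sub0r c'even.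
    by congr (_ * c' _); lia.
  by rewrite null_const mulr0.
under eq_bigr do rewrite pk mulrBl.
rewrite sumrB big_ord_recl [X in _ - X]big_ord_recr /= !coefXM coef_poly ltnn.
rewrite !(mulr0, mul0r) add0r addr0.
have -> : \sum_(s < n.+1) ('X * q)`_(bump 0 s) * c' (k.+1%:Z - (bump 0 s)%:Z) = 0.
  rewrite -[RHS](oq k kn'); apply: eq_bigr => s _; have sn := ltn_ord s.
  rewrite coefXM /bump /= c'E; last by lia.
  by congr (_ * c _); lia.
rewrite sub0r (reindex_inj rev_ord_inj) /=.
transitivity (- ((-1) ^+ n *
    \sum_(s < n.+1) q`_s * c ((n - k.+1)%:Z - s%:Z))).
  rewrite mulr_sumr; congr (- _); apply: eq_bigr => s _; have sn := ltn_ord s.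
  rewrite coef_poly subSS; have -> : (n - s < n.+1)%N by lia.
  rewrite subKn; last by lia.
  rewrite -mulrA -c'even c'E; last by lia.
  by congr (_ * (_ * c _)); lia.
by rewrite oq ?mulr0 ?oppr0 //; lia.
Qed.

Lemma minor_invmx (R : realType) (n : nat) (C : 'M[R]_n.+1) (r s : 'I_n.+1) :
  C \in unitmx ->
  \det (delete_row_col r s C) = \det C * ((-1) ^+ (s + r) * invmx C s r).
Proof.
move=> uC; rewrite /invmx uC !mxE /cofactor (addnC s r).
rewrite mulrCA (mulrA (\det C)) mulfV -?unitfE -?unitmxE // mul1r.
by rewrite mulrA -expr2 sqrr_sign mul1r.
Qed.

Unset Implicit Arguments.
Set Strict Implicit.
Set Printing Implicit Defensive.

Theorem theorem2p2 (R : realType) (n : nat) (c : int -> R) (Q : {poly R[i]}) :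
  (1 <= n)%N ->
  (forall j : nat, (j <= n)%N -> c (- j%:Z) = c j%:Z) ->
  posdef (toeplitz c n.+1) ->
  monic_orthogonal c n Q ->
  (zeros_on_right_semicircle (paraorth n Q) <->
     hurwitz (paraorth n Q \Po (- 'X))) /\
  (zeros_on_right_semicircle (paraorth n Q) ->
     (forall r s : 'I_n.+1,
        0 < \det (delete_row_col r s (toeplitz c n.+1))) /\
     (forall a : int -> R,
        (forall j : nat, (j <= n)%N -> a (- j%:Z) = a j%:Z) ->
        posdef (toeplitz a n.+1) ->
        (forall j : nat, (j <= n)%N -> 0 <= (-1) ^+ j * (c j%:Z - a j%:Z)) ->
        \det (toeplitz a n.+1) <= \det (toeplitz c n.+1) /\
        (\det (toeplitz a n.+1) = \det (toeplitz c n.+1) <->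
           toeplitz a n.+1 = toeplitz c n.+1))).
Proof.
move=> n0 cE posC orthQ.
have [c' [p [c'E TE [sp mp] PE nullP]]] := paraorth_opuc_null cE posC orthQ.
have posC' : posdef (toeplitz c' n.+1) by rewrite TE.
have sP : size (paraorth n Q) = n.+2 by rewrite PE size_map_poly.
split.
  have rootN z : root (paraorth n Q \Po - 'X) z = root (paraorth n Q) (- z).
    by rewrite /root horner_comp hornerN hornerX.
  split=> [right z|hur z Pz].
    by rewrite rootN => /right[_]; rewrite raddfN oppr_gt0.
  split; first exact: (normr1_root_opuc_null c'E posC' sP nullP).
  have := hur (- z); rewrite rootN opprK => /(_ Pz).
  by rewrite raddfN oppr_lt0.
move=> right.
have inv_pos (r s : 'I_n.+1) : 0 < (-1) ^+ (r + s) * invmx (toeplitz c n.+1) r s.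
  rewrite -TE; apply: (invmx_toeplitz_checkerboard c'E posC' sp mp).
    by rewrite -PE.
  by move=> z; rewrite -PE => /right[].
split=> [r s|a aE posA ac].
  rewrite minor_invmx ?posdef_unitmx // mulr_gt0 ?inv_pos //.
  exact: posdef_det_gt0.
apply: det_checkerboard_compare => // r s; rewrite !mxE.
have rs : (`|r%:Z - s%:Z| <= n)%N by have := ltn_ord r; have := ltn_ord s; lia.
rewrite (even_seq_abs cE rs) (even_seq_abs aE rs).
have := ac _ rs; congr (0 <= _ * _).
rewrite -signr_odd -[RHS]signr_odd; congr (_ ^+ nat_of_bool _); lia.
Qed.
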